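(* Let $\mathbf{A}_1\in\mathbb{H}^{m\times n}_{r_1}$, $\mathbf{A}_2\in\mathbb{H}^{m\times p}_{r_2}$, $\mathbf{C}\in\mathbb{H}^{m\times r}$, let $\mathbf{M}=\mathbf{R}_{A_1}\mathbf{A}_2$ with $\operatorname{rank}\mathbf{M}=r_4$, and let $\mathbf{X}_1=\mathbf{A}_1^\dagger\mathbf{C}-\mathbf{A}_1^\dagger\mathbf{A}_2\mathbf{M}^\dagger\mathbf{C}=(x^{(1)}_{ij})\in\mathbb{H}^{n\times r}$ and $\mathbf{X}_2=\mathbf{M}^\dagger\mathbf{C}=(x^{(2)}_{gf})\in\mathbb{H}^{p\times r}$. Let $\tilde{\mathbf{a}}^{(2)}_{.t}$ be the $t$th column of $\mathbf{A}_1^*\mathbf{A}_2$, and let $\mathbf{c}^{(1)}_{.j}$, $\mathbf{c}^{(2)}_{.j}$ be the $j$th columns of $\mathbf{C}_1=\mathbf{A}_1^*\mathbf{C}$ and $\mathbf{C}_2=\mathbf{M}^*\mathbf{C}$. Then $$x^{(1)}_{ij}=\frac{\sum_{\beta\in J_{r_1,n}\{i\}}\mathrm{cdet}_i\big((\mathbf{A}_1^*\mathbf{A}_1)_{.i}(\mathbf{c}^{(1)}_{.j})\big)^\beta_\beta}{\sum_{\beta\in J_{r_1,n}}|\mathbf{A}_1^*\mathbf{A}_1|^\beta_\beta}-\frac{\sum_{t=1}^p\sum_{\beta\in J_{r_1,n}\{i\}}\mathrm{cdet}_i\big((\mathbf{A}_1^*\mathbf{A}_1)_{.i}(\tilde{\mathbf{a}}^{(2)}_{.t})\big)^\beta_\beta\sum_{\beta\in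 J_{r_4,p}\{t\}}\mathrm{cdet}_t\big((\mathbf{M}^*\mathbf{M})_{.t}(\mathbf{c}^{(2)}_{.j})\big)^\beta_\beta}{\sum_{\beta\in J_{r_1,n}}|\mathbf{A}_1^*\mathbf{A}_1|^\beta_\beta\sum_{\beta\in J_{r_4,p}}|\mathbf{M}^*\mathbf{M}|^\beta_\beta},$$ $$x^{(2)}_{gf}=\frac{\sum_{\beta\in J_{r_4,p}\{g\}}\mathrm{cdet}_g\big((\mathbf{M}^*\mathbf{M})_{.g}(\mathbf{c}^{(2)}_{.f})\big)^\beta_\beta}{\sum_{\beta\in J_{r_4,p}}|\mathbf{M}^*\mathbf{M}|^\beta_\beta}.$$
   Context: $\mathbb{H}$ is the skew field of real quaternions; $\mathbb{H}^{m\times n}$ is the set of $m\times n$ matrices over $\mathbb{H}$ and $\mathbb{H}^{m\times n}_r$ the subset of those of rank $r$. $\mathbf{A}^*$ is the conjugate transpose and $\mathbf{A}^\dagger$ the Moore–Penrose inverse (the unique $\mathbf{X}$ with $\mathbf{AXA}=\mathbf{A}$, $\mathbf{XAX}=\mathbf{X}$, $(\mathbf{AX})^*=\mathbf{AX}$, $(\mathbf{XA})^*=\mathbf{XA}$). $\mathbf{R}_A=\mathbf{I}-\mathbf{A}\mathbf{A}^\dagger$. For a matrix $\mathbf{F}$, $\mathbf{F}_{.j}(\mathbf{b})$ is $\mathbf{F}$ with its $j$th column replaced by the column $\mathbf{b}$. Column determinants: for $\mathbf{F}=(a_{ij})\in\mathbb{H}^{n\times n}$, $\mathrm{cdet}_j\mathbf{F}=\sum_{\tau\in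 S_n}(-1)^{n-r}(a_{j_{k_r}j_{k_r+l_r}}\cdots a_{j_{k_r+1}j_{k_r}})\cdots(a_{j\,j_{k_1+l_1}}\cdots a_{j_{k_1+1}j_{k_1}}a_{j_{k_1}j})$, where $\tau=(j_{k_r+l_r}\cdots j_{k_r+1}\,j_{k_r})\cdots(j_{k_2+l_2}\cdots j_{k_2})(j_{k_1+l_1}\cdots j_{k_1+1}\,j_{k_1}\,j)$ is the decomposition of $\tau$ into $r$ disjoint cycles (fixed points included) with $j_{k_2}<\cdots<j_{k_r}$ and $j_{k_t}<j_{k_t+s}$ for $t=2,\dots,r$, $s=1,\dots,l_t$. For Hermitian $\mathbf{F}$ all $\mathrm{cdet}_j\mathbf{F}$ coincide and are real; this value is $\det\mathbf{F}$. Index sets: $L_{k,n}$ is the set of strictly increasing sequences $\beta=(\beta_1<\cdots<\beta_k)$ in $\{1,\dots,n\}$; $J_{k,n}\{j\}=\{\beta\in L_{k,n}: j\in\beta\}$; sums over $J_{k,n}$ without braces run over all of $L_{k,n}$. For a square $\mathbf{F}$, $\mathbf{F}^\beta_\beta$ is the principal submatrix with rows and columns indexed by $\beta$; $\mathrm{cdet}_i(\mathbf{G})^\beta_\beta$ is the column determinant of the principal submatrix $\mathbf{G}^\beta_\beta$ taken at the column coming from index $i$; for Hermitian $\mathbf{F}$, $|\mathbf{F}|^\beta_\beta=\det\mathbf{F}^\beta_\beta$. *)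

(* Defs.v *)
From HB Require Import structures.
From mathcomp Require Import all_boot all_order all_algebra all_fingroup.
From mathcomp Require Import reals.
From mathcomp Require Import ring.
Set Implicit Arguments. Unset Strict Implicit. Unset Printing Implicit Defensive.
Import Order.TTheory GRing.Theory Num.Theory.
Local Open Scope ring_scope.

Record quat (R : realType) := Quat { q0 : R; q1 : R; q2 : R; q3 : R }.

Definition quat_to (R : realType) (q : quat R) := (q0 q, q1 q, q2 q, q3 q).
Definition quat_of (R : realType) (x : R * R * R * R) :=
  Quat x.1.1.1 x.1.1.2 x.1.2 x.2.
Lemma quat_toK (R : realType) : cancel (@quat_to R) (@quat_of R).
Proof. by case. Qed.
HB.instance Definition _ (R : realType) :=
  Choice.copy (quat R) (can_type (@quat_toK R)).

Definition qzero (R : realType) : quat R := Quat 0 0 0 0.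
Definition qone (R : realType) : quat R := Quat 1 0 0 0.
Definition qopp (R : realType) (a : quat R) :=
  Quat (- q0 a) (- q1 a) (- q2 a) (- q3 a).
Definition qadd (R : realType) (a b : quat R) :=
  Quat (q0 a + q0 b) (q1 a + q1 b) (q2 a + q2 b) (q3 a + q3 b).
(* Hamilton product: i^2 = j^2 = k^2 = ijk = -1 *)
Definition qmul (R : realType) (a b : quat R) :=
  Quat (q0 a * q0 b - q1 a * q1 b - q2 a * q2 b - q3 a * q3 b)
       (q0 a * q1 b + q1 a * q0 b + q2 a * q3 b - q3 a * q2 b)
       (q0 a * q2 b - q1 a * q3 b + q2 a * q0 b + q3 a * q1 b)
       (q0 a * q3 b + q1 a * q2 b - q2 a * q1 b + q3 a * q0 b).

Lemma qaddA (R : realType) : associative (@qadd R).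
Proof. by case=> ????[????][????]; rewrite /qadd /=; f_equal; ring. Qed.
Lemma qaddC (R : realType) : commutative (@qadd R).
Proof. by case=> ????[????]; rewrite /qadd /=; f_equal; ring. Qed.
Lemma qadd0 (R : realType) : left_id (@qzero R) (@qadd R).
Proof. by case=> ????; rewrite /qadd /=; f_equal; ring. Qed.
Lemma qaddN (R : realType) : left_inverse (@qzero R) (@qopp R) (@qadd R).
Proof. by case=> ????; rewrite /qadd /qzero /=; f_equal; ring. Qed.

HB.instance Definition _ (R : realType) :=
  GRing.isZmodule.Build (quat R) (@qaddA R) (@qaddC R) (@qadd0 R) (@qaddN R).

Lemma qmulA (R : realType) : associative (@qmul R).
Proof. by case=> ????[????][????]; rewrite /qmul /=; f_equal; ring. Qed.
Lemma qmul1 (R : realType) : left_id (@qone R) (@qmul R).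
Proof. by case=> ????; rewrite /qmul /=; f_equal; ring. Qed.
Lemma qmulr1 (R : realType) : right_id (@qone R) (@qmul R).
Proof. by case=> ????; rewrite /qmul /=; f_equal; ring. Qed.
Lemma qmulDl0 (R : realType) : left_distributive (@qmul R) (@qadd R).
Proof. by case=> ????[????][????]; rewrite /qmul /qadd /=; f_equal; ring. Qed.
Lemma qmulDr0 (R : realType) : right_distributive (@qmul R) (@qadd R).
Proof. by case=> ????[????][????]; rewrite /qmul /qadd /=; f_equal; ring. Qed.
Lemma qmulDl (R : realType) : left_distributive (@qmul R) +%R.
Proof. exact: qmulDl0. Qed.
Lemma qmulDr (R : realType) : right_distributive (@qmul R) +%R.
Proof. exact: qmulDr0. Qed.
Lemma qone_neq0 (R : realType) : @qone R != 0.
Proof. by apply/eqP; case=> /eqP; rewrite oner_eq0. Qed.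

HB.instance Definition _ (R : realType) :=
  GRing.Zmodule_isNzRing.Build (quat R) (@qmulA R) (@qmul1 R) (@qmulr1 R)
    (@qmulDl R) (@qmulDr R) (@qone_neq0 R).

Definition qconj (R : realType) (a : quat R) : quat R :=
  Quat (q0 a) (- q1 a) (- q2 a) (- q3 a).
Definition qreal (R : realType) (x : R) : quat R := Quat x 0 0 0.
Definition qnorm2 (R : realType) (a : quat R) : R :=
  q0 a ^+ 2 + q1 a ^+ 2 + q2 a ^+ 2 + q3 a ^+ 2.
(* a^{-1} = conj(a) / |a|^2  (and 0^{-1} = 0) *)
Definition qinv (R : realType) (a : quat R) : quat R :=
  qmul (qreal (qnorm2 a)^-1) (qconj a).
Definition qdiv (R : realType) (a b : quat R) : quat R := a * qinv b.

Definition qadj (R : realType) m n (A : 'M[quat R]_(m, n)) : 'M[quat R]_(n, m) :=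
  \matrix_(i, j) qconj (A j i).

Definition is_MP (R : realType) m n (A : 'M[quat R]_(m, n)) (X : 'M[quat R]_(n, m)) :=
  [/\ A *m X *m A = A, X *m A *m X = X,
      qadj (A *m X) = A *m X & qadj (X *m A) = X *m A].

Definition col_indep (R : realType) m n (A : 'M[quat R]_(m, n)) (S : {set 'I_n}) :=
  forall lam : 'I_n -> quat R,
    (forall i, \sum_(j in S) A i j * lam j = 0) -> forall j, j \in S -> lam j = 0.

Definition qrank (R : realType) m n (A : 'M[quat R]_(m, n)) (r : nat) :=
  (exists S : {set 'I_n}, #|S| = r /\ col_indep A S) /\
  (forall S : {set 'I_n}, col_indep A S -> (#|S| <= r)%N).

Definition colrep (R : realType) n (F : 'M[quat R]_n) (j : 'I_n) (b : 'cV[quat R]_n)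
  : 'M[quat R]_n := \matrix_(a, c) if c == j then b a 0 else F a c.

Definition cyc_prod (R : realType) n (F : 'M[quat R]_n) (s : 'S_n) (x : 'I_n) : quat R :=
  \prod_(k < #|porbit s x|) F ((s ^+ k)%g x) ((s ^+ k.+1)%g x).

Definition cyc_lead n (s : 'S_n) (j x : 'I_n) : bool :=
  (x \notin porbit s j) && [forall y in porbit s x, (x <= y)%N].

(* cdet_j F = sum_s (-1)^(n - r) (cycles not through j, ordered with
   decreasing leading (= least) elements) * (cycle through j, started at j),
   r = number of cycles of s (fixed points included). *)
Definition cdet (R : realType) n (F : 'M[quat R]_n) (j : 'I_n) : quat R :=
  \sum_(s : 'S_n)
    (-1) ^+ (n - #|porbits s|) *
    ((\prod_(k < n | cyc_lead s j (rev_ord k)) cyc_prod F s (rev_ord k)) *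
     cyc_prod F s j).

(* determinant of a Hermitian matrix: the common value of its column
   determinants (det of the 0x0 matrix is 1) *)
Definition hdet (R : realType) n (F : 'M[quat R]_n) : quat R :=
  (match n return 'M[quat R]_n -> quat R with
   | 0 => fun _ => 1
   | n'.+1 => fun F => cdet F ord0
   end) F.

(* principal submatrix F^beta_beta, beta listed increasingly *)
Definition psub (R : realType) n (F : 'M[quat R]_n) (beta : {set 'I_n})
  : 'M[quat R]_#|beta| :=
  \matrix_(a, b) F (enum_val a) (enum_val b).

(* cdet_i (F)^beta_beta : column determinant of F^beta_beta at the column
   coming from index i (i \in beta; the position is unique) *)
Definition cdet_sub (R : realType) n (F : 'M[quat R]_n) (beta : {set 'I_n}) (i : 'I_n)
  : quat R :=
  if [pick a : 'I_#|beta| | enum_val a == i] is Some a then cdet (psub F beta) a else 0.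

Definition hdet_sub (R : realType) n (F : 'M[quat R]_n) (beta : {set 'I_n}) : quat R :=
  hdet (psub F beta).

(* Main.v *)
(** Write [G = A^* A] and let [R b] be the matrix of left cofactors of the
   principal submatrix of [G] on the index set [b] ([cofac]).  Cutting the cycle
   through [i] just before [i] and contracting its last vertex [l] gives
   [R b i l = - sum_(x in b \ l) R (b \ l) i x * G x l] for [i != l], and
   [R b i i] is the determinant on [b \ i].  For Hermitian [G], induction on [b]
   then shows that the determinants are real, that [R b] is Hermitian, and that
   [G_b * R b = det G_b].

   Summing over the [b] of size [k] turns this into the Faddeev-LeVerrier
   recursion [B_(k+1) = d_k - B_k G], with [tr (B_k G) = k d_k].  If [s] is the
   last index with [d_s != 0], the recursion gives [B_k G = 0] for [k > s], since
   [B G^2 = 0] implies [B G = 0]; hence [B_s A^* = d_s A^+].  Comparing real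
   traces in [B_s G = d_s A^+ A] gives [s = Re tr (A^+ A) = rank A], so that
   [d_r A^+ C = B_r A^* C] with [d_r != 0], which is the asserted Cramer rule. *)
Require Import Defs.
From HB Require Import structures.
From mathcomp Require Import all_boot all_order all_algebra all_fingroup.
From mathcomp Require Import reals boolp ring.
Set Implicit Arguments. Unset Strict Implicit. Unset Printing Implicit Defensive.
Import Order.TTheory GRing.Theory Num.Theory.
Local Open Scope ring_scope.

(** * Orbits of a permutation and the insertion of a fixed point into a cycle *)

Section PermutationOrbits.
Variable T : finType.
Implicit Types (s : {perm T}) (x y i l : T).

Lemma expg_card_porbit s x : (s ^+ #|porbit s x|)%g x = x.
Proof. by rewrite permX iter_porbit. Qed.

Lemma card_porbit_gt0 s x : (0 < #|porbit s x|)%N.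
Proof. by rewrite lt0n card_porbit_neq0. Qed.

Lemma expg_lt_porbit s x k :
  (0 < k < #|porbit s x|)%N -> (s ^+ k)%g x != x.
Proof.
move=> /andP[k0 kN]; have := uniq_traject_porbit s x.
move=> /(nth_uniq x) -/(_ k 0%N); rewrite size_traject => /(_ kN (ltn_trans k0 kN)).
by rewrite !nth_traject ?(ltn_trans k0 kN) // permX /= => ->; case: k k0 {kN}.
Qed.

Lemma porbit_sub (A : {set T}) s x :
  x \in A -> (forall y, y \in A -> s y \in A) -> porbit s x \subset A.
Proof.
move=> xA sA; apply/subsetP => _ /porbitP[k ->].
elim: k => [|k IH]; first by rewrite expg0 perm1.
by rewrite expgSr permM sA.
Qed.

Lemma porbit_sub_on (A : {set T}) s x :
  perm_on A s -> x \in A -> porbit s x \subset A.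
Proof. by move=> sA xA; apply: porbit_sub => // y; rewrite (perm_closed _ sA). Qed.

Lemma expg_last_porbit s x : (s ^+ #|porbit s x|.-1)%g x = (s^-1)%g x.
Proof.
apply: (@perm_inj _ s); rewrite permKV -permM -expgSr.
by rewrite prednK ?card_porbit_gt0 // expg_card_porbit.
Qed.

Lemma perm_on_setD1 (A : {set T}) s x :
  perm_on (A :\ x) s = perm_on A s && (s x == x).
Proof.
apply/idP/andP => [sA|[sA sx]].
  split; last by rewrite (out_perm sA) // !inE eqxx.
  by apply/subsetP => y /(subsetP sA); rewrite !inE => /andP[].
apply/subsetP => y sy; rewrite !inE (subsetP sA) // andbT.
by apply: contraTneq sy => ->; rewrite -[_ \in _]/(s x != x) sx.
Qed.

(* [s * tperm l i] inserts the fixed point [l] of [s] just before [i] in the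
   cycle of [i]. *)
Section InsertFixpoint.
Variables (s : {perm T}) (i l : T).
Hypotheses (il : i != l) (sl : s l = l).
Let u := (s * tperm l i)%g.

Let l_notin : l \notin porbit s i.
Proof.
rewrite porbit_sym; apply: contra il.
have /subsetP sub : porbit s l \subset [set l].
  by apply: porbit_sub; rewrite ?inE // => y /set1P ->; rewrite sl inE.
by move=> /sub; rewrite inE.
Qed.

Lemma insert_expg k : (k < #|porbit s i|)%N -> (u ^+ k)%g i = (s ^+ k)%g i.
Proof.
elim: k => [|k IH] kN; first by rewrite !expg0 !perm1.
rewrite !expgSr permM IH 1?ltnW // /u permM -(permM (s ^+ k)%g) -expgSr tpermD //.
  by apply: contraNneq l_notin => ->; rewrite mem_porbit.
by rewrite eq_sym expg_lt_porbit.
Qed.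

Lemma insert_expg_last : (u ^+ #|porbit s i|)%g i = l.
Proof.
have N0 := card_porbit_gt0 s i.
rewrite -(prednK N0) expgSr permM insert_expg ?prednK // /u permM -(permM (s ^+ _)%g) -expgSr.
by rewrite prednK // expg_card_porbit tpermR.
Qed.

Lemma insert_porbit : porbit u i = l |: porbit s i.
Proof.
apply/eqP; rewrite eqEsubset; apply/andP; split.
  apply: porbit_sub; first by rewrite !inE porbit_id orbT.
  move=> y; rewrite !inE /u permM => /predU1P[->|yi].
    by rewrite sl tpermL porbit_id orbT.
  have syi : s y \in porbit s i.
    by case/porbitP: yi => k ->; rewrite -permM -expgSr mem_porbit.
  case: tpermP => [_|_|_ _]; first by rewrite porbit_id orbT.
    by rewrite eqxx.
  by rewrite syi orbT.
apply/subsetP => y; rewrite !inE => /predU1P[->|].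
  by rewrite -insert_expg_last mem_porbit.
rewrite porbit_traject => /trajectP[k kN ->].
by rewrite -permX -insert_expg // mem_porbit.
Qed.

Lemma insert_card_porbit : #|porbit u i| = #|porbit s i|.+1.
Proof. by rewrite insert_porbit cardsU1 l_notin. Qed.

Lemma insert_expg_out x k : x \notin porbit u i -> (u ^+ k)%g x = (s ^+ k)%g x.
Proof.
rewrite insert_porbit !inE negb_or => /andP[xl xi].
elim: k => [|k IH]; first by rewrite !expg0 !perm1.
rewrite !expgSr permM IH /u permM -(permM (s ^+ k)%g) -expgSr tpermD //.
  apply: contraNneq xl => E; apply/eqP; apply: (@perm_inj _ (s ^+ k.+1)%g).
  rewrite -E; elim: k.+1 => [|j IHj]; first by rewrite expg0 perm1.
  by rewrite expgSr permM -IHj sl.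
by apply: contraNneq xi => E; rewrite porbit_sym E mem_porbit.
Qed.

Lemma insert_porbit_out x : x \notin porbit u i -> porbit u x = porbit s x.
Proof.
move=> xi; apply/setP => y; apply/porbitP/porbitP => -[k ->]; exists k;
  by rewrite insert_expg_out.
Qed.

End InsertFixpoint.
End PermutationOrbits.

(** * Column determinants over index sets and their cofactors *)

Section Cofactors.
Variables (R : realType) (n : nat).
Implicit Types (F : 'M[quat R]_n) (s : 'S_n) (b : {set 'I_n}) (i l x : 'I_n).

Definition orbit_min s x := [forall y in porbit s x, (x <= y)%N].

(** Indexing by a subset of ['I_n] keeps the type fixed when an index is removed. The reversed
    enumeration orders the cycles by decreasing least element, as in [cdet]. *)
Definition other_cycles F b s i : quat R :=
  \prod_(x <- rev (enum b) | cyc_lead s i x) cyc_prod F s x.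

Definition path_prod F s i : quat R :=
  \prod_(k < #|porbit s i|.-1) F ((s ^+ k)%g i) ((s ^+ k.+1)%g i).

(** No cycle is singled out, so the empty set is covered as well; for nonempty [b] this is the
    column determinant at the least index. *)
Definition set_det F b : quat R :=
  \sum_(s | perm_on b s)
    (-1) ^+ s * \prod_(x <- rev (enum b) | orbit_min s x) cyc_prod F s x.

Definition set_cdet F b i : quat R :=
  \sum_(s | perm_on b s) (-1) ^+ s * (other_cycles F b s i * cyc_prod F s i).

(* The left cofactor of [F l i] in the column determinant at [i]. *)
Definition cofac F b i l : quat R :=
  \sum_(s | perm_on b s && (s l == i))
    (-1) ^+ s * (other_cycles F b s i * path_prod F s i).

Lemma cyc_prod_recr F s i :
  cyc_prod F s i = path_prod F s i * F ((s^-1)%g i) i.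
Proof.
rewrite /cyc_prod /path_prod; have := expg_last_porbit s i.
have := expg_card_porbit s i; have := card_porbit_gt0 s i.
by case: #|_| => // N _ E1 E2; rewrite big_ord_recr /= E1 E2.
Qed.

Lemma sum_perm_preim b i (w : 'S_n -> quat R) (f : 'I_n -> quat R) : i \in b ->
  \sum_(s | perm_on b s) w s * f ((s^-1)%g i) =
  \sum_(l in b) (\sum_(s | perm_on b s && (s l == i)) w s) * f l.
Proof.
move=> ib; rewrite (partition_big (fun s : 'S_n => (s^-1)%g i) (mem b)) /=.
  apply: eq_bigr => l lb; rewrite big_distrl /=; apply: eq_big => [s|s /andP[_ /eqP->]//].
  congr (_ && _); apply/eqP/eqP => [<-|<-]; by rewrite ?permKV ?permK.
by move=> s sb; rewrite (perm_closed _ (perm_onV sb)).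
Qed.

Lemma set_cdet_cofac F b i : i \in b ->
  set_cdet F b i = \sum_(l in b) cofac F b i l * F l i.
Proof.
move=> ib; rewrite -(sum_perm_preim _ (fun l => F l i)) //.
by apply: eq_bigr => s _; rewrite cyc_prod_recr !mulrA.
Qed.

Lemma rev_enum_setD1 b i :
  rev (enum (b :\ i)) = [seq x <- rev (enum b) | x != i].
Proof.
rewrite filter_rev; congr rev; rewrite /enum_mem -filter_predI.
by apply: eq_filter => x; rewrite !inE.
Qed.

Lemma set_det0 F : set_det F set0 = 1.
Proof.
rewrite /set_det (big_pred1 1%g) => [|s].
  by rewrite odd_perm1 expr0 mul1r enum_set0 big_nil.
apply/idP/eqP => [s0|->]; last exact: perm_on1.
by apply: perm_on_id s0 _; rewrite cards0.
Qed.

Lemma sorted_enum_ord_set b : sorted ltn (map val (enum b)).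
Proof.
rewrite /enum_mem; apply: (subseq_sorted ltn_trans (s2 := map val (enum 'I_n))).
  by apply: map_subseq; rewrite enumT filter_subseq.
by rewrite val_enum_ord iota_ltn_sorted.
Qed.

(** The cycle through the least index is led by that index, so in decreasing order it comes last,
    exactly where [set_cdet] puts the distinguished cycle. *)
Lemma set_det_min F b i : i \in b -> (forall x, x \in b -> (i <= x)%N) ->
  set_det F b = set_cdet F b i.
Proof.
move=> ib imin; apply: eq_bigr => s sb; congr (_ * _); rewrite /other_cycles.
have sub := subsetP (porbit_sub_on sb ib).
have lead x : x \in b -> x != i -> orbit_min s x = cyc_lead s i x.
  rewrite /cyc_lead => xb xi; case: (boolP (x \in porbit s i)) => //= xs.
  apply/negbTE; apply: contra xi => /'forall_implyP/(_ i).
  rewrite porbit_sym => /(_ xs) le_xi; apply/eqP/val_inj/anti_leq.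
  by rewrite le_xi imin.
have : uniq (enum b) := enum_uniq b; have : i \in enum b by rewrite mem_enum.
have := sorted_enum_ord_set b.
have mem_b x : x \in enum b -> x \in b by rewrite mem_enum.
case: (enum b) mem_b => // y e mem_b srt iye uniq_ye.
have Ey : y = i.
  apply/eqP; rewrite -(inj_eq val_inj) eqn_leq imin ?mem_b ?mem_head // andbT.
  move: iye; rewrite inE => /predU1P[->//|ie]; apply: ltnW.
  move: srt => /= /(order_path_min ltn_trans)/allP; apply.
  exact: map_f.
subst y; rewrite rev_cons -cats1 !big_cat /=; congr (_ * _); last first.
  rewrite big_cons big_nil; case: ifP => [_|/negP[]]; first by rewrite mulr1.
  by apply/'forall_implyP => x /sub; apply: imin.
rewrite [in RHS]big_cons big_nil {2}/cyc_lead porbit_id /= mulr1.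
rewrite big_seq_cond [RHS]big_seq_cond; apply: eq_bigl => x.
rewrite mem_rev; case xe: (x \in e) => //=; apply: lead.
  by rewrite mem_b // inE xe orbT.
by apply: contraTneq xe => ->; case/andP: uniq_ye.
Qed.

Lemma cofac_diag F b i : cofac F b i i = set_det F (b :\ i).
Proof.
rewrite /cofac /set_det; apply: eq_big => [s|s /andP[_ /eqP si]].
  by rewrite perm_on_setD1.
have Ei : porbit s i = [set i].
  apply/eqP; rewrite eqEsubset sub1set porbit_id andbT.
  by apply: porbit_sub; rewrite ?inE // => y /set1P->; rewrite si inE.
rewrite /path_prod Ei cards1 /= big_ord0 mulr1; congr (_ * _).
rewrite /other_cycles rev_enum_setD1 big_filter_cond.
by apply: eq_bigl => x; rewrite /cyc_lead Ei inE.
Qed.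

Lemma cofac_offdiag F b i l : i \in b -> l \in b -> i != l ->
  cofac F b i l = - \sum_(x in b :\ l) cofac F (b :\ l) i x * F x l.
Proof.
move=> ib lb il; rewrite -(sum_perm_preim _ (fun x => F x l)); last by rewrite !inE il.
(* Multiplication by [tperm l i] matches the permutations of [b :\ l] with those of [b] sending [l]
   to [i]; its odd parity is the source of the minus sign. *)
rewrite /cofac (reindex_inj (mulIg (tperm l i))) /= -sumrN.
have tb : perm_on b (tperm l i).
  by apply: subset_trans (tperm_on l i) _; rewrite subUset !sub1set lb ib.
have cond s : perm_on b (s * tperm l i)%g && ((s * tperm l i)%g l == i) =
              perm_on (b :\ l) s.
  rewrite perm_on_setD1; congr (_ && _); last first.
    by rewrite permM -{2}(tpermL l i) (inj_eq perm_inj).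
  apply/idP/idP => sb; last exact: perm_onM.
  by rewrite -(mulgK (tperm l i) s) tpermV perm_onM.
apply: eq_big => // s; rewrite cond perm_on_setD1 => /andP[_ /eqP sl].
have Eo : other_cycles F b (s * tperm l i)%g i = other_cycles F (b :\ l) s i.
  rewrite /other_cycles rev_enum_setD1 big_filter_cond; apply: eq_big => [x|x].
    rewrite /cyc_lead; case: (boolP (x \in porbit (_ * _) i)) => [|xu] /=.
      rewrite insert_porbit // !inE => /predU1P[->|->]; first by rewrite eqxx.
      by rewrite andbF.
    have := xu; rewrite insert_porbit // !inE negb_or => /andP[-> ->] /=.
    by rewrite /orbit_min insert_porbit_out.
  case/andP => xu _; rewrite /cyc_prod insert_porbit_out //.
  by apply: eq_bigr => k _; rewrite !insert_expg_out.
have Ep : path_prod F (s * tperm l i)%g i = path_prod F s i * F ((s^-1)%g i) l.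
  rewrite /path_prod insert_card_porbit //=.
  have := @insert_expg_last _ s i l il sl; have := @insert_expg _ s i l il sl.
  have := expg_last_porbit s i; have := card_porbit_gt0 s i.
  case: #|porbit s i| => // N _ /= E1 E2 E3.
  rewrite big_ord_recr /= E2 // E3 E1; congr (_ * _); apply: eq_bigr => k _.
  by rewrite !E2 ?ltnS // ltnW.
by rewrite Eo Ep odd_permM odd_tperm eq_sym il addbT signrN mulNr !mulrA.
Qed.

(** A cofactor at [i] never reads column [i]: the other cycles avoid [i], and the path stops before
    returning to it. *)
Lemma cofac_colrep F b i l v : cofac (colrep F i v) b i l = cofac F b i l.
Proof.
apply: eq_bigr => s _.
have Eo : other_cycles (colrep F i v) b s i = other_cycles F b s i.
  apply: eq_bigr => x /andP[xi _]; apply: eq_bigr => k _; rewrite mxE ifN //.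
  by apply: contraNneq xi => <-; rewrite porbit_sym mem_porbit.
have Ep : path_prod (colrep F i v) s i = path_prod F s i.
  apply: eq_bigr => k _; rewrite mxE ifN // expg_lt_porbit //=.
  by rewrite -ltn_predRL.
by rewrite Eo Ep.
Qed.

Lemma set_cdet_colrep F b i v : i \in b ->
  set_cdet (colrep F i v) b i = \sum_(l in b) cofac F b i l * v l 0.
Proof.
move=> ib; rewrite set_cdet_cofac //; apply: eq_bigr => l _.
by rewrite cofac_colrep mxE eqxx.
Qed.

Lemma leq_enum_val b (x y : 'I_#|b|) :
  ((enum_val x : 'I_n) <= enum_val y)%N = (x <= y)%N.
Proof.
have srt := sorted_enum_ord_set b.
have sz (z : 'I_#|b|) : (z < size (enum b))%N by rewrite -cardE.
have lt (z t : 'I_#|b|) : (z < t)%N -> ((enum_val z : 'I_n) < enum_val t)%N.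
  have x0 : 'I_n := enum_val z.
  move=> zt; rewrite !(enum_val_nth x0).
  have := sorted_ltn_nth ltn_trans 0%N srt; rewrite size_map.
  by move=> /(_ z t (sz z) (sz t) zt); rewrite !(nth_map x0).
case: (ltngtP x y) => [xy|xy|/val_inj->]; last exact: leqnn.
  by rewrite ltnW // lt.
by apply/negbTE; rewrite -ltnNge lt.
Qed.

Lemma enum_map_enum_val b : enum b = [seq enum_val a | a <- enum 'I_#|b|].
Proof.
case: (pickP (mem b)) => [x0 _|b0]; last first.
  have b0' : #|b| = 0%N by apply: eq_card0.
  by rewrite [enum b]size0nil -?cardE // [RHS]size0nil // size_map size_enum_ord.
apply: (@eq_from_nth _ x0) => [|k]; first by rewrite size_map size_enum_ord cardE.
rewrite -cardE => kb; have k' : 'I_#|b| := Ordinal kb.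
rewrite (nth_map (Ordinal kb)) ?size_enum_ord // (enum_val_nth x0).
by rewrite nth_enum_ord.
Qed.

Lemma rev_enum_ord m : rev (enum 'I_m) = [seq rev_ord k | k <- enum 'I_m].
Proof.
apply: (inj_map val_inj); rewrite map_rev val_enum_ord.
rewrite -map_comp; apply: (@eq_from_nth _ 0%N).
  by rewrite size_rev size_iota size_map size_enum_ord.
move=> k; rewrite size_rev size_iota => km.
rewrite nth_rev ?size_iota // nth_iota ?rev_ord_proof //; last first.
  by rewrite ltn_subrL (leq_ltn_trans _ km).
by rewrite (nth_map (Ordinal km)) ?size_enum_ord //= nth_enum_ord.
Qed.

(** * Transfer from principal submatrices to index sets, extending permutations by the identity *)

Section Extension.
Variable b : {set 'I_n}.
Implicit Types (t : 'S_#|b|) (a c : 'I_#|b|).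

Definition ext_fun t x : 'I_n :=
  if [pick a : 'I_#|b| | enum_val a == x] is Some a then enum_val (t a) else x.

Lemma ext_fun_val t a : ext_fun t (enum_val a) = enum_val (t a).
Proof.
rewrite /ext_fun; case: pickP => [c /eqP/enum_val_inj->//|/(_ a)].
by rewrite eqxx.
Qed.

Lemma ext_fun_out t x : x \notin b -> ext_fun t x = x.
Proof.
rewrite /ext_fun; case: pickP => // a /eqP<- /negP[]; exact: enum_valP.
Qed.

Lemma ex_enum_val x : x \in b -> exists a : 'I_#|b|, x = enum_val a.
Proof. by move=> xb; exists (enum_rank_in xb x); rewrite enum_rankK_in. Qed.

Lemma ext_fun_inj t : injective (ext_fun t).
Proof.
apply: (can_inj (g := ext_fun (t^-1)%g)) => x.
case: (boolP (x \in b)) => [/ex_enum_val[a ->]|xb]; last by rewrite !ext_fun_out.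
by rewrite !ext_fun_val permK.
Qed.

Definition ext_perm t : 'S_n := perm (@ext_fun_inj t).

Lemma ext_perm_val t a : ext_perm t (enum_val a) = enum_val (t a).
Proof. by rewrite permE ext_fun_val. Qed.

Lemma ext_permX t k a : (ext_perm t ^+ k)%g (enum_val a) = enum_val ((t ^+ k)%g a).
Proof.
elim: k => [|k IH]; first by rewrite !expg0 !perm1.
by rewrite !expgSr !permM IH ext_perm_val.
Qed.

Lemma ext_perm_on t : perm_on b (ext_perm t).
Proof.
apply/subsetP => x; rewrite inE permE; apply: contraR => xb.
by rewrite ext_fun_out.
Qed.

Lemma ext_perm_inj : injective ext_perm.
Proof.
move=> t u E; apply/permP => a; apply: enum_val_inj.
by rewrite -!ext_perm_val E.
Qed.

Lemma sum_perm_on (w : 'S_n -> quat R) :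
  \sum_(s | perm_on b s) w s = \sum_(t : 'S_#|b|) w (ext_perm t).
Proof.
transitivity (\sum_(s in [set ext_perm t | t in [set: 'S_#|b|]]) w s); last first.
  rewrite big_imset; last by move=> t u _ _; exact: ext_perm_inj.
  by apply: eq_bigl => t; rewrite inE.
suff <- : [set s | perm_on b s] = [set ext_perm t | t in [set: 'S_#|b|]].
  by apply: eq_bigl => s; rewrite inE.
(* Surjectivity by counting: both sets have as many elements as there are permutations of [b]. *)
apply/esym/eqP; rewrite eqEcard; apply/andP; split.
  by apply/subsetP => _ /imsetP[t _ ->]; rewrite inE ext_perm_on.
rewrite card_imset; last exact: ext_perm_inj.
by rewrite cardsT card_Sn cardsE card_perm.
Qed.

Lemma ext_permM t u : ext_perm (t * u)%g = (ext_perm t * ext_perm u)%g.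
Proof.
apply/permP => x; rewrite permM.
case: (boolP (x \in b)) => [/ex_enum_val[a ->]|xb].
  by rewrite !ext_perm_val permM.
by rewrite !(out_perm (ext_perm_on _)).
Qed.

Lemma ext_perm_tperm a c : ext_perm (tperm a c) = tperm (enum_val a) (enum_val c).
Proof.
apply/permP => x; case: (boolP (x \in b)) => [/ex_enum_val[d ->]|xb].
  rewrite ext_perm_val; case: tpermP => [->|->|]; rewrite ?tpermL ?tpermR //.
  by move=> da dc; rewrite tpermD // (inj_eq enum_val_inj) eq_sym; apply/eqP.
rewrite (out_perm (ext_perm_on _)) // tpermD //; apply: contraNneq xb => <-;
  exact: enum_valP.
Qed.

(** Extension is multiplicative and sends transpositions to transpositions, so a factorisation into
    transpositions carries the parity over. *)
Lemma odd_ext_perm t : odd_perm (ext_perm t) = odd_perm t.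
Proof.
have [ts -> dts] := prod_tpermP t.
elim: ts dts => [|[a c] ts IH] /=.
  move=> _; rewrite big_nil odd_perm1 -[RHS](odd_perm1 'I_n); congr odd_perm.
  apply/permP => x; rewrite perm1.
  case: (boolP (x \in b)) => [/ex_enum_val[d ->]|xb].
    by rewrite ext_perm_val perm1.
  by rewrite (out_perm (ext_perm_on _)).
case/andP => _ /IH E; rewrite big_cons ext_permM !odd_permM E ext_perm_tperm.
by rewrite !odd_tperm (inj_eq enum_val_inj).
Qed.

Lemma porbit_ext t a :
  porbit (ext_perm t) (enum_val a) = [set enum_val c | c in porbit t a].
Proof.
apply/setP => x; apply/porbitP/imsetP => [[k ->]|[_ /porbitP[k ->] ->]].
  by exists ((t ^+ k)%g a); rewrite ?mem_porbit // ext_permX.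
by exists k; rewrite ext_permX.
Qed.

Lemma cyc_prod_ext F t a :
  cyc_prod F (ext_perm t) (enum_val a) = cyc_prod (psub F b) t a.
Proof.
rewrite /cyc_prod porbit_ext card_imset; last exact: enum_val_inj.
by apply: eq_bigr => k _; rewrite !ext_permX mxE.
Qed.

Lemma cyc_lead_ext t a c :
  cyc_lead (ext_perm t) (enum_val a) (enum_val c) = cyc_lead t a c.
Proof.
rewrite /cyc_lead !porbit_ext mem_imset; last exact: enum_val_inj.
congr (_ && _); apply/'forall_implyP/'forall_implyP => H x.
  by move=> xc; rewrite -leq_enum_val; apply: H; apply: imset_f.
by case/imsetP => d dc ->; rewrite leq_enum_val H.
Qed.

Lemma cdet_psub F a : cdet (psub F b) a = set_cdet F b (enum_val a).
Proof.
rewrite /set_cdet sum_perm_on; apply: eq_bigr => t _.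
(* There are at most [#|b|] orbits, so the subtraction is not truncated and its parity is that of
   [t]. *)
have Es : (-1) ^+ (#|b| - #|porbits t|) = (-1) ^+ ext_perm t :> quat R.
  rewrite odd_ext_perm -signr_odd oddB ?card_ord //.
    by rewrite /odd_perm card_ord.
  by rewrite -[X in (_ <= X)%N]card_ord leq_imset_card.
have Eo : other_cycles F b (ext_perm t) (enum_val a) =
    \prod_(k < #|b| | cyc_lead t a (rev_ord k)) cyc_prod (psub F b) t (rev_ord k).
  rewrite /other_cycles enum_map_enum_val -map_rev rev_enum_ord.
  transitivity (\prod_(k <- enum 'I_#|b| | cyc_lead t a (rev_ord k))
      cyc_prod (psub F b) t (rev_ord k)); last first.
    by rewrite [index_enum _]unlock enumT.
  rewrite !big_map; apply: eq_big => [k|k _]; first by rewrite cyc_lead_ext.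
  by rewrite cyc_prod_ext.
by rewrite Es Eo cyc_prod_ext.
Qed.

End Extension.

Lemma cdet_subE F b i : i \in b -> cdet_sub F b i = set_cdet F b i.
Proof.
rewrite /cdet_sub => /ex_enum_val[a ->]; case: pickP => [c /eqP <-|/(_ a)].
  exact: cdet_psub.
by rewrite eqxx.
Qed.

Lemma hdet_dim0 m (A : 'M[quat R]_m) : m = 0%N -> hdet A = 1.
Proof. by case: m A. Qed.

(** Describing the first index by its value makes this applicable in dimension [#|b|], which is not
    syntactically a successor. *)
Lemma hdet_cdet m (A : 'M[quat R]_m) (a : 'I_m) : a = 0%N :> nat -> hdet A = cdet A a.
Proof. by case: m A a => [A []|m A a /= a0] //; congr cdet; apply: val_inj. Qed.

Lemma hdet_subE F b : hdet_sub F b = set_det F b.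
Proof.
have [->|b_neq0] := eqVneq b set0.
  by rewrite set_det0 /hdet_sub hdet_dim0 // cards0.
have b_gt0 : (0 < #|b|)%N by rewrite card_gt0.
pose a := Ordinal b_gt0.
rewrite /hdet_sub (@hdet_cdet _ _ a) // cdet_psub (@set_det_min _ _ (enum_val a)) //.
  exact: enum_valP.
by move=> x /ex_enum_val[c ->]; rewrite leq_enum_val.
Qed.
End Cofactors.

(** * Quaternion arithmetic *)

Section Quaternions.
Variable R : realType.
Implicit Types a b c : quat R.

Lemma quat_ext a b :
  q0 a = q0 b -> q1 a = q1 b -> q2 a = q2 b -> q3 a = q3 b -> a = b.
Proof. by case: a b => ????[????] /= -> -> -> ->. Qed.

Lemma qmulE a b : a * b = qmul a b. Proof. by []. Qed.
Lemma qaddE a b : a + b = qadd a b. Proof. by []. Qed.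

Lemma qconjM a b : qconj (a * b) = qconj b * qconj a.
Proof. by rewrite !qmulE; apply: quat_ext; rewrite /=; ring. Qed.

Lemma qconjD a b : qconj (a + b) = qconj a + qconj b.
Proof. by rewrite !qaddE; apply: quat_ext; rewrite /=; ring. Qed.

Lemma qconj0 : qconj 0 = 0 :> quat R.
Proof. by apply: quat_ext; rewrite /= ?oppr0. Qed.

Lemma qconj1 : qconj 1 = 1 :> quat R.
Proof. by apply: quat_ext; rewrite /= ?oppr0. Qed.

Lemma qconjN a : qconj (- a) = - qconj a.
Proof. by []. Qed.

Lemma qconjK : involutive (@qconj R).
Proof. by move=> a; apply: quat_ext; rewrite /= ?opprK. Qed.

Lemma qconj_sum (I : finType) (P : pred I) (f : I -> quat R) :
  qconj (\sum_(i | P i) f i) = \sum_(i | P i) qconj (f i).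
Proof. exact: (big_morph (@qconj R) qconjD qconj0). Qed.

Lemma qreal_q0 a : qconj a = a -> a = qreal (q0 a).
Proof.
have zero (x : R) : - x = x -> x = 0.
  by move=> /eqP; rewrite eq_sym -subr_eq0 opprK -mulr2n mulrn_eq0 => /eqP.
by case: a => a0 a1 a2 a3 [] /zero-> /zero-> /zero->.
Qed.

Lemma qrealC (x : R) a : qreal x * a = a * qreal x.
Proof. by rewrite !qmulE; apply: quat_ext; rewrite /=; ring. Qed.

(** Self-conjugate quaternions are real, hence central. This is how determinants are moved past
    other factors below. *)
Lemma self_conjC a b : qconj a = a -> a * b = b * a.
Proof. by move=> /qreal_q0 ->; exact: qrealC. Qed.

Lemma qrealM (x y : R) : qreal (x * y) = qreal x * qreal y.
Proof. by rewrite !qmulE; apply: quat_ext; rewrite /=; ring. Qed.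

Lemma qmul_conj a : qconj a * a = qreal (qnorm2 a).
Proof. by rewrite !qmulE; apply: quat_ext; rewrite /= /qnorm2; ring. Qed.

Lemma qnorm2_ge0 a : 0 <= qnorm2 a.
Proof. by rewrite /qnorm2 !addr_ge0 ?sqr_ge0. Qed.

Lemma qnorm2_eq0 a : (qnorm2 a == 0) = (a == 0).
Proof.
apply/eqP/eqP => [|->]; last by rewrite /qnorm2 /= expr0n /= !addr0.
rewrite /qnorm2 => /eqP; rewrite !paddr_eq0 ?addr_ge0 ?sqr_ge0 // !sqrf_eq0.
by case: a => ???? /= /andP[/andP[/andP[/eqP-> /eqP->] /eqP->] /eqP->].
Qed.

Lemma qmulVq a : a != 0 -> qinv a * a = 1.
Proof.
rewrite -qnorm2_eq0 => a0; rewrite /qinv -qmulE -mulrA qmul_conj -qrealM.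
by rewrite mulVf.
Qed.

Lemma qmulqV a : a != 0 -> a * qinv a = 1.
Proof.
rewrite -qnorm2_eq0 => a0; rewrite /qinv -qmulE mulrA -qrealC -mulrA.
rewrite (_ : a * qconj a = qreal (qnorm2 a)); last first.
  by rewrite !qmulE; apply: quat_ext; rewrite /= /qnorm2; ring.
by rewrite -qrealM mulVf.
Qed.

Lemma qmul_eq0 a b : a * b = 0 -> a = 0 \/ b = 0.
Proof.
have [->|a0] := eqVneq a 0; first by left.
by move=> ab0; right; rewrite -[b]mul1r -(qmulVq a0) -mulrA ab0 mulr0.
Qed.

End Quaternions.

(** * The adjugate identity for principal blocks of a Hermitian matrix *)

Section HermitianCofactors.
Variables (R : realType) (n : nat) (F : 'M[quat R]_n).
Hypothesis herm : forall i j, qconj (F i j) = F j i.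
Implicit Types (b : {set 'I_n}) (i j k l x y : 'I_n).
Local Notation D := (set_det F).
Local Notation C := (cofac F).

Definition adjugate_spec b :=
  [/\ qconj (D b) = D b,
      {in b &, forall i l, qconj (C b i l) = C b l i} &
      {in b &, forall k l, \sum_(i in b) F k i * C b i l = (k == l)%:R * D b}].

(** Conjugating the right-hand adjugate identity gives the left-hand one. *)
Lemma adjugate_specl b : adjugate_spec b ->
  {in b &, forall i k, \sum_(l in b) C b i l * F l k = (i == k)%:R * D b}.
Proof.
case=> rD hC FC i k ib kb; apply: (can_inj (@qconjK R)).
transitivity (\sum_(l in b) F k l * C b l i).
  by rewrite qconj_sum; apply: eq_bigr => l lb; rewrite qconjM herm hC.
by rewrite FC // qconjM rD eq_sym; case: eqP => _;
  rewrite ?qconj1 ?qconj0 ?mulr1 ?mul1r ?mulr0 ?mul0r.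
Qed.

Section Step.
Variable b : {set 'I_n}.
Hypothesis IH : forall b', b' \proper b -> adjugate_spec b'.

Let IH1 l : l \in b -> adjugate_spec (b :\ l).
Proof. by move=> lb; apply: IH; rewrite properD1. Qed.

Let IH2 i l : l \in b -> adjugate_spec (b :\ l :\ i).
Proof.
move=> lb; apply: IH; apply: sub_proper_trans (properD1 lb); exact: subD1set.
Qed.

(** The second expansion is applied to the conjugate of the inner cofactor. It removes [i] as the
    first removed [l], leaving a form in which conjugation visibly exchanges [i] and [l]. *)
Lemma cofac_expand2 i l : i \in b -> l \in b -> i != l ->
  C b i l = - (D (b :\ l :\ i) * F i l) +
    \sum_(x in b :\ l :\ i) \sum_(y in b :\ l :\ i)
       F i y * C (b :\ l :\ i) y x * F x l.
Proof.
move=> ib lb il; have ibl : i \in b :\ l by rewrite !inE il.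
rewrite cofac_offdiag // (big_setD1 i) //= cofac_diag opprD; congr (_ + _).
have [_ hC1 _] := IH1 lb; have [_ hC2 _] := IH2 i lb.
rewrite -sumrN; apply: eq_bigr => x xg.
have := xg; rewrite !inE => /and3P[xi xl xb].
have xbl : x \in b :\ l by rewrite !inE xl.
rewrite -big_distrl /= -mulNr; congr (_ * _); apply: (can_inj (@qconjK R)).
rewrite qconjN hC1 // cofac_offdiag // opprK qconj_sum.
by apply: eq_bigr => y yg; rewrite qconjM herm hC2.
Qed.

Lemma cofac_herm : {in b &, forall i l, qconj (C b i l) = C b l i}.
Proof.
move=> i l ib lb; have [<-|il] := eqVneq i l.
  by rewrite cofac_diag; case: (IH1 ib).
have [rD hC _] := IH2 i lb.
rewrite cofac_expand2 // cofac_expand2 1?eq_sym //.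
have -> : b :\ i :\ l = b :\ l :\ i by rewrite !setDDl setUC.
rewrite qconjD qconjN qconjM herm rD (self_conjC _ rD); congr (_ + _).
rewrite qconj_sum exchange_big /=; apply: eq_bigr => x xg.
rewrite qconj_sum; apply: eq_bigr => y yg.
by rewrite !qconjM !herm hC // mulrA.
Qed.

(** The term [i = l] is [F k l * D (b :\ l)]. Expanding the other cofactors at [l] and using the
    adjugate identity on [b :\ l] yields its negative. *)
Lemma offdiag_mul_cofac k l : k \in b -> l \in b -> k != l ->
  \sum_(i in b) F k i * C b i l = 0.
Proof.
move=> kb lb kl; have [rD _ FC] := IH1 lb.
have kbl : k \in b :\ l by rewrite !inE kl.
rewrite (big_setD1 l) //= cofac_diag -(self_conjC _ rD); apply/eqP.
rewrite addr_eq0 -sumrN; apply/eqP.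
transitivity (\sum_(i in b :\ l) \sum_(x in b :\ l) F k i * C (b :\ l) i x * F x l).
  rewrite exchange_big /= (big_setD1 k) //= [X in _ + X]big1 => [|x].
    by rewrite -big_distrl /= FC // eqxx mul1r addr0.
  rewrite in_setD1 => /andP[xk xbl].
  by rewrite -big_distrl /= FC // [k == x]eq_sym (negbTE xk) !mul0r.
apply: eq_bigr => i; rewrite !inE => /andP[il ib].
rewrite cofac_offdiag // mulrN opprK big_distrr /=.
by apply: eq_bigr => x _; rewrite mulrA.
Qed.

(** The diagonal entries of [F C], not yet known to agree. *)
Definition diag_val l : quat R := \sum_(i in b) F l i * C b i l.

Lemma diag_val_real l : l \in b -> qconj (diag_val l) = diag_val l.
Proof.
move=> lb; have [rD hC FC] := IH1 lb.
have -> : diag_val l = F l l * D (b :\ l) -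
    \sum_(i in b :\ l) \sum_(x in b :\ l) F l i * C (b :\ l) i x * F x l.
  rewrite /diag_val (big_setD1 l) //= cofac_diag -sumrN; congr (_ + _).
  apply: eq_bigr => i; rewrite !inE => /andP[il ib].
  rewrite cofac_offdiag // mulrN big_distrr /=; congr (- _).
  by apply: eq_bigr => x _; rewrite mulrA.
rewrite qconjD qconjN qconjM herm rD -(self_conjC _ rD); congr (_ - _).
rewrite qconj_sum exchange_big /=; apply: eq_bigr => x xg.
rewrite qconj_sum; apply: eq_bigr => y yg.
by rewrite !qconjM !herm hC // mulrA.
Qed.

Lemma diag_val_left l : l \in b -> diag_val l = \sum_(i in b) C b l i * F i l.
Proof.
move=> lb; rewrite -diag_val_real // qconj_sum; apply: eq_bigr => i ib.
by rewrite qconjM herm cofac_herm.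
Qed.

(* Both sides are the [(k, l)] entry of [F C F]. *)
Lemma diag_val_comm k l : k \in b -> l \in b ->
  diag_val k * F k l = diag_val l * F k l.
Proof.
move=> kb lb.
have FC x y : x \in b -> y \in b ->
    \sum_(i in b) F x i * C b i y = (x == y)%:R * diag_val y.
  move=> xb yb; case: eqVneq => [->|xy]; first by rewrite mul1r.
  by rewrite mul0r offdiag_mul_cofac.
rewrite [RHS](self_conjC _ (diag_val_real lb)).
transitivity (\sum_(i in b) \sum_(j in b) F k i * C b i j * F j l).
  rewrite exchange_big /= (bigD1 k) //= [X in _ + X]big1 => [|x /andP[xb xk]].
    by rewrite -big_distrl /= FC // eqxx mul1r addr0.
  by rewrite -big_distrl /= FC // [k == x]eq_sym (negbTE xk) !mul0r.
have CF x y : x \in b -> y \in b ->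
    \sum_(i in b) C b x i * F i y = (x == y)%:R * diag_val y.
  move=> xb yb; case: eqVneq => [->|xy]; first by rewrite mul1r diag_val_left.
  rewrite mul0r; apply: (can_inj (@qconjK R)); rewrite qconj_sum qconj0.
  have yx : y != x by rewrite eq_sym.
  rewrite -[RHS](offdiag_mul_cofac yb xb yx).
  by apply: eq_bigr => i ib; rewrite qconjM herm cofac_herm.
rewrite (bigD1 l) //= [X in _ + X]big1 => [|x /andP[xb xl]].
  under eq_bigr do rewrite -mulrA.
  by rewrite -big_distrr /= CF // eqxx mul1r addr0.
under eq_bigr do rewrite -mulrA.
by rewrite -big_distrr /= CF // (negbTE xl) mul0r mulr0.
Qed.

(** At the least index the column determinant equals [D b], so it only remains to show that the
    diagonal values agree. *)
Lemma set_det_diag_val : b != set0 -> exists2 i, i \in b & D b = diag_val i.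
Proof.
case/set0Pn => i0 i0b; case: (arg_minnP (fun i : 'I_n => nat_of_ord i) i0b) => i ib imin.
exists i => //; rewrite diag_val_left // -set_cdet_cofac //.
exact: set_det_min.
Qed.

End Step.

(** Induction on the size of [b1]: the expansion at a column [l] of [b1] only meets rows of [b1],
    since [F] vanishes on the rows of [b2] there. *)
Lemma cofac_block b1 b2 :
    [disjoint b1 & b2] -> {in b2 & b1, forall x y, F x y = 0} ->
    (forall b', b' \proper b1 :|: b2 -> adjugate_spec b') ->
  {in b1 &, forall i l, C (b1 :|: b2) i l = C b1 i l * D b2}.
Proof.
move: {2}#|b1| (leqnn #|b1|) => m; elim: m b1 => [|m IHm] b1.
  by rewrite leqn0 cards_eq0 => /eqP-> _ _ _ i l; rewrite inE.
move=> card_b1 dis F0 IH i l ib1 lb1.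
have notb2 x : x \in b1 -> x \notin b2 by move=> xb1; rewrite (disjointFr dis).
have sub x : (b1 :\ x) :|: b2 \subset b1 :|: b2 by rewrite setSU ?subD1set.
have setU_D1 x : x \in b1 -> (b1 :|: b2) :\ x = (b1 :\ x) :|: b2.
  move=> xb1; rewrite setDUl; congr (_ :|: _); apply/setDidPl.
  by rewrite disjoint_sym disjoints1 notb2.
have prop x : x \in b1 -> (b1 :\ x) :|: b2 \proper b1 :|: b2.
  by move=> xb1; rewrite -setU_D1 // properD1 // inE xb1.
have block x : x \in b1 ->
    {in b1 :\ x &, forall i l, C (b1 :\ x :|: b2) i l = C (b1 :\ x) i l * D b2}.
  move=> xb1; apply: IHm.
  - by rewrite -ltnS (leq_trans _ card_b1) // [X in (_ < X)%N](cardsD1 x) xb1.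
  - by apply: disjointWl dis; exact: subD1set.
  - by move=> u v ub2; rewrite inE => /andP[_ vb1]; rewrite F0.
  - by move=> b' pb'; apply: IH; apply: proper_sub_trans pb' _.
have [rD2 _ _] : adjugate_spec b2.
  by apply: IH; apply: sub_proper_trans (prop _ ib1); exact: subsetUr.
have [<-|il] := eqVneq i l.
  rewrite !cofac_diag setU_D1 //.
  have [->|] := eqVneq (b1 :\ i) set0; first by rewrite set0U set_det0 mul1r.
  case/set0Pn => j jb1.
  (* Both determinants are read off as the [(j, j)] entry of cofactors times [F], which reduces the
     diagonal case to cofactors over [b1 :\ i]. *)
  have jU : j \in b1 :\ i :|: b2 by rewrite inE jb1.
  have := adjugate_specl (IH _ (prop _ ib1)) jU jU; rewrite eqxx mul1r => <-.
  have p1 : b1 :\ i \proper b1 :|: b2.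
    by apply: sub_proper_trans (prop _ ib1); exact: subsetUl.
  have := adjugate_specl (IH _ p1) jb1 jb1; rewrite eqxx mul1r => <-.
  rewrite big_distrl /= (big_setID (b1 :\ i)) /= setUK [X in _ + X]big1 => [|x].
    rewrite addr0; apply: eq_bigr => x xb1.
    by rewrite block // -!mulrA (self_conjC _ rD2).
  rewrite in_setD in_setU => /andP[/negbTE-> /= xb2].
  by rewrite F0 ?mulr0 //; move: jb1; rewrite inE => /andP[].
have il1 : i \in b1 :\ l by rewrite !inE il.
rewrite cofac_offdiag ?inE ?ib1 ?lb1 // cofac_offdiag // setU_D1 // mulNr.
congr (- _); rewrite big_distrl /= (big_setID (b1 :\ l)) /= setUK.
rewrite [X in _ + X]big1 => [|x].
  rewrite addr0; apply: eq_bigr => x xb1.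
  by rewrite (block l) // -!mulrA (self_conjC _ rD2).
rewrite in_setD in_setU => /andP[/negbTE-> /= xb2].
by rewrite F0 ?mulr0.
Qed.

(* If the diagonal values of [F C] differ, [F] is block diagonal along their
   level sets, and then each of them is the product of the two blocks. *)
Lemma diag_val_const b : (forall b', b' \proper b -> adjugate_spec b') ->
  {in b &, forall i l, diag_val b i = diag_val b l}.
Proof.
move=> IH i l ib lb; apply/eqP; apply: contraT => il.
pose b1 := [set x in b | diag_val b x == diag_val b i].
pose b2 := b :\: b1.
have sb1 : b1 \subset b by apply/subsetP => x; rewrite inE => /andP[].
have b12 : b1 :|: b2 = b by rewrite /b2 setDE setUIr setUCr setIT; apply/setUidPr.
have dis : [disjoint b1 & b2] by rewrite -setI_eq0 /b2 setIDA setIC -setIDA setDv setI0.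
have ib1 : i \in b1 by rewrite inE ib eqxx.
have lb2 : l \in b2 by rewrite /b2 !inE lb andbT /= eq_sym.
have F0 x y : x \in b1 -> y \in b2 -> F x y = 0 /\ F y x = 0.
  rewrite /b2 !inE => /andP[xb /eqP xi] /andP[+ yb]; rewrite yb /= => yi.
  have Fxy : F x y = 0.
    have /eqP := diag_val_comm IH xb yb; rewrite -subr_eq0 -mulrBl => /eqP/qmul_eq0.
    by case=> // /eqP; rewrite subr_eq0 xi eq_sym (negbTE yi).
  by split=> //; rewrite -herm Fxy qconj0.
have p1 : b1 \proper b.
  by apply/properP; split => //; exists l => //; rewrite inE lb eq_sym.
have p2 : b2 \proper b.
  by apply/properP; split; [exact: subsetDl | exists i => //; rewrite inE ib1].
have val c1 c2 x : c1 :|: c2 = b -> [disjoint c1 & c2] ->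
    {in c2 & c1, forall x y, F x y = 0} -> c1 \proper b -> c2 \proper b ->
    x \in c1 -> diag_val b x = D c1 * D c2.
  move=> c12 dc F0c pc1 pc2 xc1.
  have xb : x \in b by rewrite -c12 inE xc1.
  rewrite (diag_val_left IH) //.
  have [rD2 _ _] := IH _ pc2.
  have := adjugate_specl (IH _ pc1) xc1 xc1; rewrite eqxx mul1r => <-.
  rewrite -c12 big_distrl /= (big_setID c1) /= setUK [X in _ + X]big1 => [|y].
    rewrite addr0; apply: eq_bigr => y yc1.
    by rewrite cofac_block ?c12 // -!mulrA (self_conjC _ rD2).
  by rewrite in_setD in_setU => /andP[/negbTE-> /= yc2]; rewrite F0c ?mulr0.
have [rD1 _ _] := IH _ p1.
move: il; rewrite (val b1 b2) //; last by move=> x y xb2 yb1; case: (F0 y x).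
rewrite (val b2 b1 l) //.
- by rewrite (self_conjC _ rD1) eqxx.
- by rewrite setUC.
- by rewrite disjoint_sym.
- by move=> x y xb1 yb2; case: (F0 x y).
Qed.

Lemma adjugateP b : adjugate_spec b.
Proof.
move: {2}#|b| (leqnn #|b|) => m; elim: m b => [|m IHm] b.
  rewrite leqn0 cards_eq0 => /eqP->; split; rewrite ?set_det0 ?qconj1 //;
  by move=> i l; rewrite inE.
move=> card_b.
have IH b' : b' \proper b -> adjugate_spec b'.
  by move=> /proper_card lt; apply: IHm; rewrite -ltnS (leq_trans lt).
have [b0|bn0] := eqVneq b set0.
  by rewrite b0; split; rewrite ?set_det0 ?qconj1 //; move=> i l; rewrite inE.
have [i ib Di] := set_det_diag_val IH bn0.
split; first by rewrite Di (diag_val_real IH).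
  exact: cofac_herm.
move=> k l kb lb; have [<-|kl] := eqVneq k l; last first.
  by rewrite mul0r (offdiag_mul_cofac IH).
by rewrite mul1r Di (diag_val_const IH ib kb).
Qed.

End HermitianCofactors.

(** * Conjugate transposes, real traces and cancellation of Gram matrices *)

Section Adjoint.
Variable R : realType.

Lemma qadjM m n p (A : 'M[quat R]_(m, n)) (B : 'M[quat R]_(n, p)) :
  qadj (A *m B) = qadj B *m qadj A.
Proof.
apply/matrixP => i j; rewrite !mxE qconj_sum.
by apply: eq_bigr => k _; rewrite !mxE qconjM.
Qed.

Lemma qadjK m n (A : 'M[quat R]_(m, n)) : qadj (qadj A) = A.
Proof. by apply/matrixP => i j; rewrite !mxE qconjK. Qed.

Lemma q0_sum (I : finType) (P : pred I) (f : I -> quat R) :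
  q0 (\sum_(i | P i) f i) = \sum_(i | P i) q0 (f i).
Proof. exact: (big_morph (@q0 R) (fun=> fun=> erefl) erefl). Qed.

Lemma q0_mulC (a b : quat R) : q0 (a * b) = q0 (b * a).
Proof. by rewrite !qmulE /=; ring. Qed.

(** Quaternion products commute only in their real part, so the trace is cyclic only after [q0]. *)
Lemma q0_tr_mulC m n (A : 'M[quat R]_(m, n)) (B : 'M[quat R]_(n, m)) :
  q0 (\tr (A *m B)) = q0 (\tr (B *m A)).
Proof.
rewrite /mxtrace !q0_sum.
under eq_bigr do rewrite mxE q0_sum.
rewrite exchange_big; apply: eq_bigr => j _; rewrite mxE q0_sum.
by apply: eq_bigr => i _; rewrite q0_mulC.
Qed.

(** The diagonal entries of [A *m qadj A] are the sums of squared norms along the rows. *)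
Lemma mul_adj_eq0 m n (A : 'M[quat R]_(m, n)) : A *m qadj A = 0 -> A = 0.
Proof.
move=> A0; apply/matrixP => i j; rewrite mxE; apply/eqP; rewrite -qnorm2_eq0.
have /(congr1 (@q0 R)) := congr1 (fun M : 'M__ => M i i) A0.
rewrite !mxE q0_sum => s0.
have qn k : q0 (A i k * qadj A k i) = qnorm2 (A i k).
  by rewrite mxE q0_mulC qmul_conj.
have /allP/(_ j) : all (fun k => true ==> (qnorm2 (A i k) == 0)) (index_enum 'I_n).
  rewrite -psumr_eq0 => [|k _]; last exact: qnorm2_ge0.
  by rewrite -(eq_bigr _ (fun k _ => qn k)) s0.
by rewrite mem_index_enum => /(_ isT).
Qed.

(** Definiteness is used twice, first for [Z *m qadj A] and then for [Z] itself. *)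
Lemma mul_gram_gram_eq0 m n p (A : 'M[quat R]_(m, n)) (B : 'M[quat R]_(p, n)) :
  B *m (qadj A *m A) *m (qadj A *m A) = 0 -> B *m (qadj A *m A) = 0.
Proof.
set Z := B *m (qadj A *m A) => Z0.
have ZA : Z *m qadj A = 0.
  by apply: mul_adj_eq0; rewrite qadjM qadjK mulmxA -(mulmxA Z) Z0 mul0mx.
apply: mul_adj_eq0; rewrite {2}/Z !qadjM qadjK !mulmxA ZA !mul0mx //.
Qed.

End Adjoint.

(** * Column rank as the real trace of a projection *)

Section Rank.
Variables (R : realType) (m n : nat) (A : 'M[quat R]_(m, n)).

(** By maximality of [S] every column is a right combination of the columns in [S]; [Y] collects the
    coefficients. *)
Lemma qrank_factor r : qrank A r -> exists (S : {set 'I_n}) (Y : 'M[quat R]_n),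
  [/\ #|S| = r, col_indep A S, A *m Y = A & forall l j, l \notin S -> Y l j = 0].
Proof.
case=> -[S [cardS indS]] maxS.
have colP j : exists y : 'I_n -> quat R,
    (forall l, l \notin S -> y l = 0) /\ (forall i, \sum_l A i l * y l = A i j).
  have [jS|jS] := boolP (j \in S).
    exists (fun l => (l == j)%:R); split=> [l lS|i].
      by case: eqP => // lj; rewrite lj jS in lS.
    rewrite (bigD1 j) //= eqxx mulr1 big1 ?addr0 // => l /negbTE->.
    by rewrite mulr0.
  have : ~ col_indep A (j |: S).
    by move=> /maxS; rewrite cardsU1 jS cardS ltnn.
  move=> /existsNP[lam /not_implyP[lam0 /existsNP[x /not_implyP[xS lamx]]]].
  have lamj : lam j != 0.
    apply/eqP => lamj0; apply: lamx.
    move: xS; rewrite !inE => /predU1P[->//|]; apply: indS => i.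
    by have := lam0 i; rewrite big_setU1 //= lamj0 mulr0 add0r.
  exists (fun l => if l \in S then - (lam l * qinv (lam j)) else 0).
  split=> [l /negbTE->//|i].
  transitivity (- (\sum_(l in S) A i l * lam l) * qinv (lam j)).
    rewrite -sumrN big_distrl /= [RHS]big_mkcond /=; apply: eq_bigr => l _.
    by case: ifP => _; rewrite ?mulr0 // mulrN mulrA mulNr.
  have := lam0 i; rewrite big_setU1 //= => /eqP; rewrite addr_eq0 => /eqP <-.
  by rewrite -mulrA qmulqV // mulr1.
have [y yP] := fin_all_exists colP.
exists S, (\matrix_(l, j) y j l); split=> //.
  apply/matrixP => i j; rewrite mxE -[RHS](yP j).2.
  by apply: eq_bigr => l _; rewrite mxE.
by move=> l j lS; rewrite mxE (yP j).1.
Qed.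

(** By cyclicity [X *m A] may be replaced by [W = Y *m (X *m A)], whose rows outside [S] vanish. As
    [A *m W = A], independence forces the diagonal entries in [S] to be 1. *)
Lemma q0_tr_projection r X : qrank A r -> A *m X *m A = A ->
  q0 (\tr (X *m A)) = r%:R.
Proof.
move=> /qrank_factor[S [Y [cardS indS AY Y0]]] AXA.
rewrite -{1}AY mulmxA q0_tr_mulC; set W := Y *m (X *m A).
have W0 l j : l \notin S -> W l j = 0.
  by move=> lS; rewrite mxE big1 // => k _; rewrite Y0 // mul0r.
have AW : A *m W = A by rewrite mulmxA AY mulmxA.
have W1 l : l \in S -> W l l = 1.
  move=> lS; apply/eqP; rewrite -subr_eq0; apply/eqP.
  pose lam x := W x l - (x == l)%:R.
  suff : forall j, j \in S -> lam j = 0 by move=> /(_ l lS); rewrite /lam eqxx.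
  apply: indS => i; rewrite /lam.
  under eq_bigr do rewrite mulrBr.
  have -> : \sum_(x in S) (A i x * W x l - A i x * (x == l)%:R) =
            \sum_(x in S) A i x * W x l - A i l.
    rewrite sumrB; congr (_ - _); rewrite (bigD1 l) //= eqxx mulr1 big1 ?addr0 //.
    by move=> x /andP[_ /negbTE->]; rewrite mulr0.
  apply/eqP; rewrite subr_eq0; apply/eqP.
  have /(congr1 (fun M : 'M__ => M i l)) := AW; rewrite mxE => <-.
  rewrite [RHS](bigID (mem S)) /= [X in _ + X]big1 ?addr0 // => x xS.
  by rewrite W0 // mulr0.
rewrite /mxtrace q0_sum (bigID (mem S)) /= [X in _ + X]big1 => [|l lS].
  rewrite addr0 (eq_bigr (fun=> 1)) => [|l lS]; last by rewrite W1.
  by rewrite sumr_const -cardS.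
by rewrite W0.
Qed.

End Rank.

(** * Sums of determinants and cofactors over index sets of a given size *)

Section CofactorSums.
Variables (R : realType) (n : nat).
Implicit Types (G : 'M[quat R]_n) (k : nat) (i l : 'I_n) (b : {set 'I_n}).

(* The coefficients of [t^(n - k)] in [det (t + G)] and [adj (t + G)], [t] real. *)
Definition det_sum G k : quat R := \sum_(b : {set 'I_n} | #|b| == k) set_det G b.

Definition adj_sum G k : 'M[quat R]_n :=
  \matrix_(i, l) \sum_(b : {set 'I_n} | (#|b| == k) && (i \in b) && (l \in b))
    cofac G b i l.

Lemma sum_setU1 k l (P : pred {set 'I_n}) (f : {set 'I_n} -> quat R) :
  \sum_(b : {set 'I_n} | (#|b| == k.+1) && P b && (l \in b)) f b =
  \sum_(b : {set 'I_n} | (#|b| == k) && P (l |: b) && (l \notin b)) f (l |: b).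
Proof.
rewrite (reindex_onto (fun b => l |: b) (fun b => b :\ l)) /=; last first.
  by move=> b /andP[_ lb]; rewrite setD1K.
apply: eq_bigl => b; rewrite setU11 andbT.
have [lb|lb] := boolP (l \in b).
  rewrite andbF; apply/negbTE; apply: contraL lb => /andP[_ /eqP <-].
  by rewrite !inE eqxx.
by rewrite setU1K // eqxx andbT cardsU1 lb add1n eqSS andbT.
Qed.

Lemma adj_sum_mul G k p (V : 'M[quat R]_(n, p)) i j :
  (adj_sum G k *m V) i j =
  \sum_(b : {set 'I_n} | (#|b| == k) && (i \in b))
    \sum_(l in b) cofac G b i l * V l j.
Proof.
rewrite mxE.
under eq_bigr do rewrite mxE big_distrl /=.
rewrite (exchange_big_dep (fun b : {set 'I_n} => (#|b| == k) && (i \in b))) /=.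
  by apply: eq_bigr => b bk; apply: eq_bigl => l; rewrite bk.
by move=> l b _ /andP[].
Qed.

Lemma sum_cdet_sub G k p (V : 'M[quat R]_(n, p)) i j :
  \sum_(b : {set 'I_n} | (#|b| == k) && (i \in b))
    cdet_sub (colrep G i (col j V)) b i = (adj_sum G k *m V) i j.
Proof.
rewrite adj_sum_mul; apply: eq_bigr => b /andP[_ ib].
rewrite cdet_subE // set_cdet_colrep //.
by apply: eq_bigr => l _; rewrite mxE.
Qed.

Lemma sum_hdet_sub G k :
  \sum_(b : {set 'I_n} | #|b| == k) hdet_sub G b = det_sum G k.
Proof. by apply: eq_bigr => b _; rewrite hdet_subE. Qed.

Lemma det_sum0 G : det_sum G 0 = 1.
Proof.
rewrite /det_sum (big_pred1 set0) ?set_det0 // => b.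
by rewrite cards_eq0.
Qed.

Lemma card_gt_false k b : (n < k)%N -> (#|b| == k) = false.
Proof.
move=> nk; apply: contraTF nk => /eqP <-; rewrite -leqNgt.
by rewrite -[X in (_ <= X)%N]card_ord max_card.
Qed.

Lemma det_sum_gt G k : (n < k)%N -> det_sum G k = 0.
Proof. by move=> nk; rewrite /det_sum big_pred0 // => b; rewrite card_gt_false. Qed.

Lemma adj_sum_gt G k : (n < k)%N -> adj_sum G k = 0.
Proof.
move=> nk; apply/matrixP => i l; rewrite !mxE big_pred0 // => b.
by rewrite card_gt_false.
Qed.

Section Hermitian.
Variable G : 'M[quat R]_n.
Hypothesis herm : forall i j, qconj (G i j) = G j i.

Lemma det_sum_real k : qconj (det_sum G k) = det_sum G k.
Proof.
rewrite qconj_sum; apply: eq_bigr => b _.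
by case: (adjugateP herm b).
Qed.

Lemma adj_sum_mul_diag k i :
  (adj_sum G k *m G) i i =
  \sum_(b : {set 'I_n} | (#|b| == k) && (i \in b)) set_det G b.
Proof.
rewrite adj_sum_mul; apply: eq_bigr => b /andP[_ ib].
by rewrite (adjugate_specl herm (adjugateP herm b)) // eqxx mul1r.
Qed.

(** Sets containing [l] contribute nothing by the adjugate identity; a set [b] avoiding [l]
    contributes minus the cofactor of [l |: b]. *)
Lemma adj_sum_mul_offdiag k i l : i != l ->
  (adj_sum G k *m G) i l = - adj_sum G k.+1 i l.
Proof.
move=> il; rewrite adj_sum_mul (bigID (fun b : {set 'I_n} => l \in b)) /=.
rewrite big1 ?add0r => [|b /andP[/andP[_ ib] lb]]; last first.
  by rewrite (adjugate_specl herm (adjugateP herm b)) // (negbTE il) mul0r.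
rewrite mxE (sum_setU1 _ _ (fun b => i \in b)) -sumrN; apply: eq_big => b.
  by rewrite !inE (negbTE il).
case/andP => /andP[_ ib] lb.
rewrite cofac_offdiag ?opprK ?setU1K //; last exact: setU11.
by rewrite !inE ib orbT.
Qed.

(** On the diagonal the sets containing [i] cancel, and each remaining determinant on [b] is the
    diagonal cofactor of [i |: b]. *)
Lemma adj_sumS k : adj_sum G k.+1 = (det_sum G k)%:M - adj_sum G k *m G.
Proof.
apply/matrixP => i l; rewrite [RHS]mxE [X in _ + X]mxE [X in X - _]mxE.
have [<-|il] := eqVneq i l; last first.
  by rewrite mulr0n sub0r adj_sum_mul_offdiag // opprK.
rewrite mulr1n adj_sum_mul_diag /det_sum.
rewrite [in RHS](bigID (fun b : {set 'I_n} => i \in b)) /= [RHS]addrAC subrr add0r.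
rewrite mxE.
transitivity (\sum_(b : {set 'I_n} | (#|b| == k.+1) && xpredT b && (i \in b))
    cofac G b i i).
  by apply: eq_bigl => b; rewrite /= andbT -andbA andbb.
rewrite sum_setU1; apply: eq_big => b; first by rewrite /= andbT.
by case/andP => _ ib; rewrite cofac_diag setU1K.
Qed.

(** Each set of size [k] is counted once for each of its elements. *)
Lemma tr_adj_sum_mul k : \tr (adj_sum G k *m G) = det_sum G k *+ k.
Proof.
rewrite /mxtrace; under eq_bigr do rewrite adj_sum_mul_diag.
rewrite (exchange_big_dep (fun b : {set 'I_n} => #|b| == k)) /=; last first.
  by move=> i b _ /andP[].
rewrite /det_sum -sumrMnl; apply: eq_bigr => b /eqP bk.
rewrite bk eqxx /= (eq_bigl (mem b)) // sumr_const.
by rewrite bk.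
Qed.

End Hermitian.
End CofactorSums.

(** * The Moore-Penrose inverse from the Faddeev-LeVerrier recursion *)

Section MoorePenrose.
Variables (R : realType) (m n : nat).
Variables (A : 'M[quat R]_(m, n)) (X : 'M[quat R]_(n, m)).
Hypothesis MP : is_MP A X.
Local Notation G := (qadj A *m A).
Local Notation B := (adj_sum G).
Local Notation d := (det_sum G).

Lemma gram_herm i j : qconj (G i j) = G j i.
Proof.
have : qadj G = G by rewrite qadjM qadjK.
by move=> /(congr1 (fun M : 'M__ => M j i)); rewrite [LHS]mxE.
Qed.

Lemma adj_MP : qadj A = G *m X.
Proof.
case: MP => AXA _ hAX _.
by rewrite -{1}AXA qadjM hAX mulmxA.
Qed.

(** With [G] as a left factor of [X], a matrix annihilating [G] from the left also annihilates
    [X]. *)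
Lemma MP_gram : X = G *m (X *m qadj X *m X).
Proof.
case: MP => _ XAX _ hXA.
by rewrite !mulmxA -adj_MP -qadjM hXA XAX.
Qed.

(** Descending induction from [k > n], where there are no index sets: once [d k = 0], the recursion
    reads [B k.+1 = - B k *m G], and one factor [G] can be cancelled. *)
Lemma adj_sum_gram0 s : (forall k, (s < k)%N -> d k = 0) ->
  forall k, (s < k)%N -> B k *m G = 0.
Proof.
move=> d0 k; move: {2}(n.+1 - k)%N (leqnn (n.+1 - k)) => j.
elim: j k => [|j IHj] k jk sk.
  by rewrite adj_sum_gt ?mul0mx // -subn_eq0 -leqn0.
apply: mul_gram_gram_eq0.
have : B k.+1 *m G = 0.
  by apply: IHj; [rewrite subnS -subn1 leq_subLR add1n | exact: ltnW].
rewrite (adj_sumS gram_herm) d0 // raddf0 sub0r mulNmx => /eqP.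
by rewrite oppr_eq0 => /eqP.
Qed.

(** Multiply the recursion for [B s.+1] by [X] on the right: its left side vanishes, and
    [G *m X = qadj A]. *)
Lemma adj_sum_MP s : (forall k, (s < k)%N -> d k = 0) ->
  B s *m qadj A = d s *: X.
Proof.
move=> d0; have BX : B s.+1 *m X = 0.
  by rewrite MP_gram mulmxA (adj_sum_gram0 d0) // mul0mx.
have -> : B s *m qadj A = B s *m G *m X by rewrite -mulmxA -adj_MP.
rewrite -[LHS]addr0 -BX -mulmxDl addrC.
by rewrite (adj_sumS gram_herm) subrK mul_scalar_mx.
Qed.

Lemma det_sum_rank r : qrank A r -> d r != 0 /\ forall k, (r < k)%N -> d k = 0.
Proof.
move=> rkA; have ex : exists k, d k != 0 by exists 0%N; rewrite det_sum0 oner_neq0.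
have bound k : d k != 0 -> (k <= n)%N.
  by apply: contraNT; rewrite -ltnNge => /(det_sum_gt G)->.
case: (ex_maxnP ex bound) => s ds smax.
have d0 k : (s < k)%N -> d k = 0.
  by rewrite ltnNge => ks; apply/eqP; apply: contraNT ks; exact: smax.
suff <- : s = r by split.
have BG : B s *m G = d s *: (X *m A) by rewrite mulmxA (adj_sum_MP d0) scalemxAl.
have : d s *+ s = d s * \tr (X *m A).
  rewrite -(tr_adj_sum_mul gram_herm) BG /mxtrace big_distrr /=.
  by apply: eq_bigr => i _; rewrite mxE.
rewrite -mulr_natr => /(congr1 (fun x => qinv (d s) * x)).
rewrite !mulrA qmulVq // !mul1r => /(congr1 (@q0 R)).
case: MP => AXA _ _ _; rewrite (q0_tr_projection rkA AXA).
have q0n k : q0 (k%:R : quat R) = k%:R by elim: k => // k IHk; rewrite !mulrS -IHk.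
by rewrite q0n => /eqP; rewrite eqr_nat => /eqP.
Qed.

End MoorePenrose.

(** * Cramer's rule and the formulas for the two blocks *)

Lemma qdiv_real_mull (R : realType) (d x : quat R) :
  d != 0 -> qconj d = d -> qdiv (d * x) d = x.
Proof. by move=> d0 rd; rewrite /qdiv (self_conjC _ rd) -mulrA qmulqV // mulr1. Qed.

(* Cramer's rule for the minimal norm least squares solution. *)
Lemma MP_cramer (R : realType) (m n p r : nat) (A : 'M[quat R]_(m, n))
    (X : 'M[quat R]_(n, m)) (V : 'M[quat R]_(m, p)) i j :
  is_MP A X -> qrank A r ->
  \sum_(b : {set 'I_n} | (#|b| == r) && (i \in b))
    cdet_sub (colrep (qadj A *m A) i (col j (qadj A *m V))) b i =
  det_sum (qadj A *m A) r * (X *m V) i j.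
Proof.
move=> MP /(det_sum_rank MP)[_ d0].
by rewrite sum_cdet_sub mulmxA (adj_sum_MP MP d0) -scalemxAl mxE.
Qed.

Theorem theorem5p6 (R : realType) (m n p r r1 r2 r4 : nat)
    (A1 : 'M[quat R]_(m, n)) (A2 : 'M[quat R]_(m, p)) (C : 'M[quat R]_(m, r))
    (A1d : 'M[quat R]_(n, m)) (Md : 'M[quat R]_(p, m)) :
  qrank A1 r1 -> qrank A2 r2 ->
  is_MP A1 A1d ->
  let M := (1%:M - A1 *m A1d) *m A2 in
  qrank M r4 -> is_MP M Md ->
  let X1 := A1d *m C - A1d *m A2 *m Md *m C in
  let X2 := Md *m C in
  let A2t := qadj A1 *m A2 in
  let C1 := qadj A1 *m C in
  let C2 := qadj M *m C in
  let G1 := qadj A1 *m A1 in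
  let G4 := qadj M *m M in
  let D1 := \sum_(beta : {set 'I_n} | #|beta| == r1) hdet_sub G1 beta in
  let D4 := \sum_(beta : {set 'I_p} | #|beta| == r4) hdet_sub G4 beta in
  (forall (i : 'I_n) (j : 'I_r),
     X1 i j =
       qdiv (\sum_(beta : {set 'I_n} | (#|beta| == r1) && (i \in beta))
               cdet_sub (colrep G1 i (col j C1)) beta i) D1
       - qdiv (\sum_(t < p)
                 (\sum_(beta : {set 'I_n} | (#|beta| == r1) && (i \in beta))
                    cdet_sub (colrep G1 i (col t A2t)) beta i) *
                 (\sum_(beta : {set 'I_p} | (#|beta| == r4) && (t \in beta))
                    cdet_sub (colrep G4 t (col j C2)) beta t))
              (D1 * D4)) /\
  (forall (g : 'I_p) (f : 'I_r),
     X2 g f =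
       qdiv (\sum_(beta : {set 'I_p} | (#|beta| == r4) && (g \in beta))
               cdet_sub (colrep G4 g (col f C2)) beta g) D4).
Proof.
move=> rk1 _ MP1 M rk4 MP4 X1 X2 A2t C1 C2 G1 G4 D1 D4.
have [d1 _] := det_sum_rank MP1 rk1; have [d4 _] := det_sum_rank MP4 rk4.
have r1d := det_sum_real (gram_herm A1) r1.
have r4d := det_sum_real (gram_herm M) r4.
have d14 : det_sum G1 r1 * det_sum G4 r4 != 0.
  by apply/eqP => /qmul_eq0[/eqP|/eqP]; apply/negP.
have r14 : qconj (det_sum G1 r1 * det_sum G4 r4) = det_sum G1 r1 * det_sum G4 r4.
  by rewrite qconjM r1d r4d -(self_conjC _ r1d).
rewrite /D1 /D4 !sum_hdet_sub; split=> [i j|g f]; last first.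
  by rewrite (MP_cramer _ _ _ MP4 rk4) qdiv_real_mull.
rewrite (MP_cramer _ _ _ MP1 rk1) qdiv_real_mull // /X1 mxE [X in _ + X]mxE.
congr (_ - _); rewrite -(mulmxA (A1d *m A2)).
(* Over the common real denominator only numerators remain. They agree term by term in [t], by
   Cramer's rule for [A1d *m A2] and [Md *m C], once the second denominator is moved past the first
   factor. *)
rewrite -(qdiv_real_mull ((A1d *m A2 *m (Md *m C)) i j) d14 r14); congr qdiv.
rewrite [X in _ * X]mxE big_distrr /=; apply: eq_bigr => t _.
rewrite (MP_cramer _ _ _ MP1 rk1) (MP_cramer _ _ _ MP4 rk4).
by rewrite -!mulrA; congr (_ * _); rewrite !mulrA (self_conjC _ r4d).
Qed.
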